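(* Let $D$ be an integral domain and let $\mathcal{X}$ be a property of integral domains which is stable under the quotient extension and the polynomial extension. Suppose that any integral domain has the property $\mathcal{X}$ whenever its Nagata ring has the property $\mathcal{X}$. Then the following assertions are equivalent. (1) $D$ is a locally $\mathcal{X}$-domain. (2) $D[X]$ is a locally $\mathcal{X}$-domain. (3) The Anderson ring $D[X]_A$ is a locally $\mathcal{X}$-domain. (4) The Serre's conjecture ring $D[X]_U$ is a locally $\mathcal{X}$-domain. (5) The Nagata ring $D[X]_N$ is a locally $\mathcal{X}$-domain.
   Context: Properties of integral domains are understood to be invariant under ring isomorphism. A domain $D$ is a locally $\mathcal{X}$-domain if $D_P$ has the property $\mathcal{X}$ for every prime ideal $P$ of $D$. $\mathcal{X}$ is stable under the quotient extension if, whenever a domain $D$ has $\mathcal{X}$, so does $D_S$ for every multiplicative subset $S$ of $D$ (not containing $0$); it is stable under the polynomial extension if, whenever a domain $D$ has $\mathcal{X}$, so does the polynomial ring $D[X]$ in one indeterminate. For a domain $D$ and $f\in D[X]$, $c(f)$ is the ideal of $D$ generated by the coefficients of $f$. Put $A=\{f\in D[X]\mid f(0)=1\}$, $U=\{f\in D[X]\mid f\text{ is monic}\}$, $N=\{f\in D[X]\mid c(f)=D\}$, which are multiplicative subsets of $D[X]$. The localizations $D[X]_A$, $D[X]_U$, $D[X]_N$ are called the Anderson ring, Serre's conjecture ring and Nagata ring of $D$, respectively. *)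

(* Defs.v *)
From HB Require Import structures.
From mathcomp Require Import all_boot all_algebra.
From mathcomp Require Import boolp.

Set Implicit Arguments.
Unset Strict Implicit.
Unset Printing Implicit Defensive.

Import GRing.Theory.
Local Open Scope ring_scope.
Local Notation "x %:F" := (@FracField.tofrac _ x).

Record multiplicative_subset (R : idomainType) := MultiplicativeSubset {
  mset :> {pred R};
  mset_mulr_closed : mulr_closed mset;
  mset_neq0 : 0 \notin mset }.

(* The localization of a domain R at S is the subring of {fraction R} whose
   elements are the a / s with s in S. *)
Definition loc_pred (R : idomainType) (S : multiplicative_subset R) :
    {pred {fraction R}} :=
  fun x => `[< exists a s : R, s \in S /\ x = a%:F / s%:F >].

Section LocSubring.
Variables (R : idomainType) (S : multiplicative_subset R).

Let mset_fracN0 s : s \in S -> s%:F != 0 :> {fraction R}.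
Proof.
by move=> Ss; rewrite tofrac_eq0; apply: contraNneq (mset_neq0 S) => <-.
Qed.

Fact loc_pred_subring : subring_closed (loc_pred S).
Proof.
have [S1 SM] := mset_mulr_closed S.
split=> [|_ _ /asboolP[a [s [Ss ->]]] /asboolP[b [t [St ->]]]
         |_ _ /asboolP[a [s [Ss ->]]] /asboolP[b [t [St ->]]]]; apply/asboolP.
- by exists 1, 1; split=> //; rewrite rmorph1 divr1.
- exists (a * t - b * s), (s * t); split; first exact: SM.
  by rewrite rmorphB !rmorphM /= -!mulNr addf_div ?mset_fracN0.
- exists (a * b), (s * t); split; first exact: SM.
  by rewrite !rmorphM /= mulf_div.
Qed.

Definition localization := {x : {fraction R} | x \in loc_pred S}.

HB.instance Definition _ := SubChoice.on localization.
HB.instance Definition _ :=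
  GRing.SubChoice_isSubComNzRing.Build {fraction R} (loc_pred S) localization
    loc_pred_subring.

Definition loc_unit : {pred localization} :=
  fun x => (val x != 0) && ((val x)^-1 \in loc_pred S).

Definition loc_inv (x : localization) : localization :=
  if loc_unit x then insubd x (val x)^-1 else x.

Fact loc_mulVx : {in loc_unit, left_inverse 1 loc_inv *%R}.
Proof.
move=> x Ux; apply: val_inj; have /andP[x0 xV] := Ux.
by rewrite rmorphM rmorph1 /loc_inv ifT //= insubdK // mulVf.
Qed.

Fact loc_unitPl (x y : localization) : y * x = 1 -> loc_unit x.
Proof.
move=> /(congr1 val); rewrite rmorphM rmorph1 /= => yx1.
have x0 : val x != 0.
  by apply: contra_eq_neq yx1 => ->; rewrite mulr0 eq_sym oner_eq0.
apply/andP; split=> //.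
by rewrite -[_^-1]mul1r -yx1 mulfK //; apply: valP.
Qed.

Fact loc_invr_out : {in [predC loc_unit], loc_inv =1 id}.
Proof. by move=> x /negPf Ux; rewrite /loc_inv ifF. Qed.

HB.instance Definition _ :=
  GRing.ComNzRing_hasMulInverse.Build localization
    loc_mulVx loc_unitPl loc_invr_out.
HB.instance Definition _ :=
  GRing.SubComUnitRing_isSubIntegralDomain.Build {fraction R} (loc_pred S)
    localization.

End LocSubring.

Section PrimeComplement.
Variables (R : idomainType) (P : prime_idealr R).

Fact prime_compl_mulr_closed : mulr_closed [predC P].
Proof.
split=> [|x y]; first by rewrite inE idealr1.
by rewrite !inE /= prime_idealrM negb_or => -> ->.
Qed.

Fact prime_compl_neq0 : 0 \notin [predC P].
Proof. by rewrite inE /= negbK idealr0. Qed.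

Definition prime_compl :=
  MultiplicativeSubset prime_compl_mulr_closed prime_compl_neq0.

End PrimeComplement.

(* Unlike the library's idealr_closed, this allows the ideal to be R itself. *)
Definition is_ideal (R : idomainType) (I : {pred R}) :=
  submod_closed (I : {pred R^o}).

Definition ideal_gen (R : idomainType) (E : {pred R}) : {pred R} :=
  fun x => `[< forall I : {pred R}, is_ideal I -> {subset E <= I} -> x \in I >].

Definition content (R : idomainType) (f : {poly R}) : {pred R} :=
  ideal_gen (mem (polyseq f)).

(* The multiplicative subsets of R[X] defining the Anderson ring (A), Serre's
   conjecture ring (U) and the Nagata ring (N). *)
Definition A_pred (R : idomainType) : {pred {poly R}} := fun f => f.[0] == 1.
Definition U_pred (R : idomainType) : {pred {poly R}} := fun f => f \is monic.
Definition N_pred (R : idomainType) : {pred {poly R}} :=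
  fun f => `[< content f =i predT >].

Section Closed.
Variable R : idomainType.

Fact A_mulr_closed : mulr_closed (@A_pred R).
Proof.
split=> [|f g]; rewrite !unfold_in; first by rewrite hornerE.
by move=> /eqP f1 /eqP g1; rewrite hornerM f1 g1 mulr1.
Qed.

Fact A_neq0 : 0 \notin @A_pred R.
Proof. by rewrite unfold_in horner0 eq_sym oner_eq0. Qed.

Fact U_mulr_closed : mulr_closed (@U_pred R).
Proof.
split=> [|f g]; rewrite ![_ \in @U_pred R]unfold_in /U_pred ?monic1 //.
by move=> fm; rewrite monicMl.
Qed.

Fact U_neq0 : 0 \notin @U_pred R.
Proof. by rewrite unfold_in /U_pred monicE lead_coef0 eq_sym oner_eq0. Qed.

Let coef_in (I : {pred R}) (f : {poly R}) :
  0 \in I -> {subset (f : seq R) <= I} -> forall i, f`_i \in I.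
Proof.
move=> I0 fI i; have [le_fi|lt_if] := leqP (size f) i.
  by rewrite nth_default.
exact/fI/mem_nth.
Qed.

Let N_predP (f : {poly R}) :
  reflect (forall I : {pred R}, is_ideal I -> (forall i, f`_i \in I) -> 1 \in I)
          (f \in @N_pred R).
Proof.
apply: (iffP (asboolP _)) => [cf I idI fI | cf x].
  have /asboolP := cf 1; apply=> // y /(nthP 0)[i _ <-]; exact: fI.
rewrite [RHS]inE; apply/asboolP => I idI fI; have [I0 IZ] := idI.
have I1 : 1 \in I by apply: cf => //; apply: coef_in.
by have := IZ x 1 0 I1 I0; rewrite addr0 /GRing.scale /= mulr1.
Qed.

Let ideal0 (I : {pred R}) : is_ideal I -> 0 \in I.
Proof. by case. Qed.
Let idealM (I : {pred R}) : is_ideal I -> forall a x, x \in I -> a * x \in I.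
Proof. by case=> I0 IZ a x Ix; rewrite -[a * x]addr0; apply: IZ. Qed.
Let idealD (I : {pred R}) :
  is_ideal I -> forall x y, x \in I -> y \in I -> x + y \in I.
Proof. by case=> I0 IZ x y Ix Iy; rewrite -[x]mul1r; apply: IZ. Qed.

Let radical (I : {pred R}) : {pred R} := fun x => `[< exists n, x ^+ n \in I >].

Let radical_ideal (I : {pred R}) : is_ideal I -> is_ideal (radical I).
Proof.
move=> idI; have M a x : x \in radical I -> a * x \in radical I.
  move=> /asboolP[n xn]; apply/asboolP; exists n.
  by rewrite exprMn; apply: idealM.
have D u v : u \in radical I -> v \in radical I -> u + v \in radical I.
  move=> /asboolP[m um] /asboolP[n vn].
  apply/asboolP; exists (m + n)%N; rewrite exprDn.
  elim/big_rec: _ => [|i x _ Ix]; first exact: ideal0.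
  apply: idealD => //; rewrite -mulr_natl; apply: idealM => //.
  have [le_in|lt_ni] := leqP i n.
    by rewrite -addnBA // exprD -mulrA mulrC; apply: idealM.
  by rewrite -(subnK (ltnW lt_ni)) exprD mulrA; apply: idealM.
split=> [|a u v ru rv]; last by apply: D => //; apply: M.
by apply/asboolP; exists 1%N; rewrite expr1; apply: ideal0.
Qed.

(* f_i g_j lies in the radical of any ideal containing the coefficients of
   f * g, by induction on i + j. *)
Let coefM_radical (I : {pred R}) (f g : {poly R}) :
  is_ideal I -> (forall k, (f * g)`_k \in I) ->
  forall i j, f`_i * g`_j \in radical I.
Proof.
move=> idI fgI i j; have idr := radical_ideal idI.
have [k def_k] : exists k, k = (i + j)%N by exists (i + j)%N.
elim/ltn_ind: k => k IHk in i j def_k *.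
suff /asboolP[n In] : (f`_i * g`_j) ^+ 2 \in radical I.
  by apply/asboolP; exists (2 * n)%N; rewrite exprM.
have lt_ik : (i < k.+1)%N by rewrite def_k ltnS leq_addr.
have fgr : (f * g)`_k \in radical I.
  by apply/asboolP; exists 1%N; rewrite expr1.
have def_fg : f`_i * g`_j = (f * g)`_k
    + -1 * (\sum_(l < k.+1 | l != Ordinal lt_ik) f`_l * g`_(k - l)).
  have -> : j = (k - i)%N by rewrite def_k addKn.
  by rewrite coefM (bigD1 (Ordinal lt_ik)) //= mulN1r addrK.
rewrite expr2 {2}def_fg mulrDr; apply: idealD => //; first exact: idealM.
rewrite mulrCA; apply: (idealM idr); rewrite mulr_sumr.
elim/big_rec: _ => [|l x ne_li Ix]; first exact: ideal0.
apply: idealD => //; have le_lk : (l <= k)%N by rewrite -ltnS.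
have [lt_li|lt_il|eq_li] := ltngtP l i.
- rewrite mulrACA [g`_j * _]mulrC mulrACA.
  apply: (idealM idr); apply: (IHk (l + j)%N) => //.
  by rewrite [ltnRHS]def_k ltn_add2r.
- rewrite mulrACA [g`_j * _]mulrC mulrACA mulrC.
  apply: (idealM idr); apply: (IHk (i + (k - l))%N) => //.
  by rewrite -ltn_subRL; apply: ltn_sub2l => //; apply: leq_trans le_lk.
- by case/eqP: ne_li; apply: val_inj.
Qed.

Fact N_mulr_closed : mulr_closed (@N_pred R).
Proof.
split=> [|f g /N_predP cf /N_predP cg]; apply/N_predP => I idI.
  by move=> /(_ 0%N); rewrite coef1.
move=> /(coefM_radical idI) fgr; have idr := radical_ideal idI.
suff /asboolP[n] : 1 \in radical I by rewrite expr1n.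
apply: cg => // j.
pose J : {pred R} := fun x => x * g`_j \in radical I.
have J1 : 1 \in J.
  apply: cf => [|i]; last exact: fgr.
  split=> [|a u v Ju Jv]; rewrite unfold_in /J ?mul0r; first exact: ideal0.
  by rewrite mulrDl /GRing.scale /= -mulrA; apply: idealD => //; apply: idealM.
by rewrite -[g`_j]mul1r.
Qed.

Fact N_neq0 : 0 \notin @N_pred R.
Proof.
apply/negP=> /N_predP/(_ (pred1 0))/=.
rewrite inE oner_eq0 => N0; suff: false by [].
apply: N0 => [|i]; last by rewrite inE coef0.
split=> [|a u v /eqP-> /eqP->]; first exact: eqxx.
by rewrite inE scaler0 addr0.
Qed.

End Closed.

Definition A_set (R : idomainType) :=
  MultiplicativeSubset (@A_mulr_closed R) (@A_neq0 R).
Definition U_set (R : idomainType) :=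
  MultiplicativeSubset (@U_mulr_closed R) (@U_neq0 R).
Definition N_set (R : idomainType) :=
  MultiplicativeSubset (@N_mulr_closed R) (@N_neq0 R).

Definition anderson_ring (R : idomainType) : idomainType :=
  localization (A_set R).
Definition serre_ring (R : idomainType) : idomainType :=
  localization (U_set R).
Definition nagata_ring (R : idomainType) : idomainType :=
  localization (N_set R).

Definition isomorphic (R S : idomainType) : Prop :=
  exists f : {rmorphism R -> S}, bijective f.

Definition isom_invariant (X : idomainType -> Prop) : Prop :=
  forall R S : idomainType, isomorphic R S -> X R -> X S.

Definition locally (X : idomainType -> Prop) (R : idomainType) : Prop :=
  forall P : prime_idealr R, X (localization (prime_compl P)).

Definition stable_quotient (X : idomainType -> Prop) : Prop :=
  forall R : idomainType, X R ->
  forall S : multiplicative_subset R, X (localization S).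

Definition stable_polynomial (X : idomainType -> Prop) : Prop :=
  forall R : idomainType, X R -> X {poly R}.

(* Main.v *)
From HB Require Import structures.
Require Import Defs.
From mathcomp Require Import all_boot all_algebra.
From mathcomp Require Import boolp.
Local Open Scope ring_scope.

Set Implicit Arguments.
Unset Strict Implicit.
Unset Printing Implicit Defensive.

Import GRing.Theory.

(** Write t for the indeterminate, X being the property. Every ring in the
    theorem is obtained from D or D[t] by inverting elements, so everything
    reduces to comparing rings of fractions.

    Going up, let Q be a prime of D[t] and P its contraction to D. The ring
    D_P[t] only inverts constants outside P, hence elements outside Q,
    so D[t]_Q is a localization
    of D_P[t] and inherits X from D_P through the polynomial and the quotient
    extension (locally_poly). Likewise, a prime Q of a localization R_S
    contracts to a prime of R at which the localization of R is the same as
    that of R_S at Q, so R_S is locally X as soon as R is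
    (locally_localization).

    Coming down, the point is that the Nagata ring of D_P is the localization
    of D[t] at the prime P[t] of the polynomials with coefficients in P
    (nagata_prime_loc): over the local ring D_P, a polynomial has unit content
    exactly when one of its coefficients is a unit, which for a polynomial
    over D means a coefficient outside P. A polynomial of unit content over D
    is not in P[t], so P[t] survives in D[t]_T for every T contained in N, and
    the Nagata ring of D_P is the localization of D[t]_T at the extension of
    P[t]. If D[t]_T is locally X, then the Nagata ring of D_P has X, hence so
    does D_P (locally_of_poly_loc). Both A and U are contained in N, because 1
    is among the coefficients of their elements.

    All the isomorphisms follow from a single principle (fractions_isom):
    a ring of fractions of R is determined by the elements of R that become
    units in it. *)

(** * Rings of fractions and their universal property *)

(** No multiplicative subset is mentioned: it can always be taken to be the
    preimage of the units. This makes the notion stable under composition and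
    lets two rings of fractions be compared by the units of R alone. *)
Definition fractions_of (R L : idomainType) (f : {rmorphism R -> L}) : Prop :=
  injective f /\
  forall y : L, exists a s : R, f s \is a GRing.unit /\ y = f a / f s.

(** The universal property: h sends f a / f s to g a / g s. *)
Lemma fractions_lift (R L L' : idomainType)
    (f : {rmorphism R -> L}) (g : {rmorphism R -> L'}) :
    fractions_of f ->
    (forall s, f s \is a GRing.unit -> g s \is a GRing.unit) ->
  exists h : {rmorphism L -> L'}, forall a, h (f a) = g a.
Proof.
move=> [f_inj fP] fgU.
have /choice[num /choice[den denP]] := fP.
pose h y := g (num y) / g (den y).
have hE a s : f s \is a GRing.unit -> h (f a / f s) = g a / g s.
  move=> Us; have [Ud /eqP] := denP (f a / f s).
  rewrite /h; set n := num _; set d := den _ in Ud *.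
  rewrite eq_sym -(can2_eq (mulrK Us) (mulrVK Us)) mulrAC.
  rewrite (can2_eq (mulrVK Ud) (mulrK Ud)) -!rmorphM => /eqP/f_inj e.
  apply: (canLR (mulrK (fgU _ Ud))); rewrite mulrAC.
  by apply: (canRL (mulrK (fgU _ Us))); rewrite -!rmorphM e.
have hf a : h (f a) = g a.
  by rewrite -[f a]divr1 -(rmorph1 f) hE ?rmorph1 ?unitr1 ?divr1.
have hB : zmod_morphism h.
  move=> x y; have [a [s [Us ->]]] := fP x; have [b [t [Ut ->]]] := fP y.
  have Ust : f (s * t) \is a GRing.unit by rewrite rmorphM unitrM Us.
  have -> : f a / f s - f b / f t = f (a * t - b * s) / f (s * t).
    apply: (mulIr Ust); rewrite mulrVK // mulrBl rmorphB !rmorphM.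
    by rewrite mulrA mulrVK // [f s * f t]mulrC mulrA mulrVK.
  rewrite !hE //; apply: (mulIr (fgU _ Ust)); rewrite mulrVK ?fgU //.
  rewrite mulrBl rmorphB !rmorphM.
  by rewrite mulrA mulrVK ?fgU // [g s * g t]mulrC mulrA mulrVK ?fgU.
have hM : monoid_morphism h.
  split=> [|x y]; first by rewrite -(rmorph1 f) hf rmorph1.
  have [a [s [Us ->]]] := fP x; have [b [t [Ut ->]]] := fP y.
  have Ust : f (s * t) \is a GRing.unit by rewrite rmorphM unitrM Us.
  have -> : f a / f s * (f b / f t) = f (a * b) / f (s * t).
    by apply: (mulIr Ust); rewrite mulrVK // !rmorphM mulrACA !mulrVK.
  rewrite !hE //; apply: (mulIr (fgU _ Ust)); rewrite mulrVK ?fgU //.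
  by rewrite !rmorphM mulrACA !mulrVK ?fgU.
pose hr : {rmorphism L -> L'} :=
  HB.pack h (GRing.isZmodMorphism.Build L L' h hB)
            (GRing.isMonoidMorphism.Build L L' h hM).
by exists hr.
Qed.

(** The uniqueness half of the universal property, for endomorphisms. *)
Lemma fractions_endo (R L : idomainType) (f : {rmorphism R -> L})
    (h : {rmorphism L -> L}) :
  fractions_of f -> (forall a, h (f a) = f a) -> h =1 id.
Proof.
by move=> [_ fP] hf y; have [a [s [Us ->]]] := fP y; rewrite rmorph_div ?hf.
Qed.

Lemma fractions_isom (R L L' : idomainType)
    (f : {rmorphism R -> L}) (g : {rmorphism R -> L'}) :
    fractions_of f -> fractions_of g ->
    (forall s, (f s \is a GRing.unit) = (g s \is a GRing.unit)) ->
  isomorphic L L'.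
Proof.
move=> fF gF fgU.
have [|h hf] := @fractions_lift _ _ _ f g fF; first by move=> s; rewrite fgU.
have [|k kg] := @fractions_lift _ _ _ g f gF; first by move=> s; rewrite fgU.
exists h; exists k.
  by apply: (fractions_endo (h := k \o h) fF) => a /=; rewrite hf kg.
by apply: (fractions_endo (h := h \o k) gF) => a /=; rewrite kg hf.
Qed.

(** If y = u / v with u = a / s and v = b / t, then y = a t / (s b). *)
Lemma fractions_comp (R L M : idomainType)
    (f : {rmorphism R -> L}) (g : {rmorphism L -> M}) :
  fractions_of f -> fractions_of g -> fractions_of (g \o f).
Proof.
move=> [f_inj fP] [g_inj gP]; split=> [|y]; first exact: inj_comp.
have [u [v [Uv ->]]] := gP y.
have [a [s [Us ->]]] := fP u.
have [b [t [Ut def_v]]] := fP v.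
exists (a * t), (s * b).
have fb : f b = v * f t by rewrite def_v mulrVK.
have Ugs := rmorph_unit g Us; have Ugt := rmorph_unit g Ut.
have Usb : g (f (s * b)) \is a GRing.unit.
  by rewrite !rmorphM fb rmorphM !unitrM Ugs Uv.
split=> //; apply: (mulIr Usb); rewrite mulrVK //= [f (s * b)]rmorphM fb.
rewrite [g (f s * _)]rmorphM [g (v * _)]rmorphM [g (f s) * _]mulrCA [LHS]mulrA.
by rewrite mulrVK // rmorph_div // [LHS]mulrA mulrVK // -rmorphM -rmorphM.
Qed.

(** The finitely many coefficients of a polynomial over L have a common
    denominator in R. *)
Lemma fractions_map_poly (R L : idomainType) (f : {rmorphism R -> L}) :
  fractions_of f -> fractions_of (map_poly f).
Proof.
move=> [f_inj fP]; split=> [|p]; first exact: map_inj_poly f_inj (rmorph0 f).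
have polyU c : c \is a GRing.unit -> (c%:P : {poly L}) \is a GRing.unit.
  by move=> Uc; apply: rmorph_unit.
suff [q [s [Us def_p]]] : exists q s,
    f s \is a GRing.unit /\ p * (f s)%:P = map_poly f q.
  exists q, s%:P; rewrite /= map_polyC polyU //; split=> //.
  by rewrite -def_p mulrK // polyU.
elim/poly_ind: p => [|p c [q [s [Us def_p]]]].
  by exists 0, 1; rewrite !rmorph0 rmorph1 unitr1 mul0r.
have [a [t [Ut ->]]] := fP c.
exists (q * t%:P * 'X + (a * s)%:P), (s * t); split.
  by rewrite rmorphM unitrM Us.
rewrite rmorphD !rmorphM /= !map_polyC map_polyX /= -def_p ?rmorphM /=.
rewrite mulrDl -!mulrA; congr (_ + _).
  by congr (_ * _); rewrite mulrC -mulrA.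
by congr (_ * _); rewrite -!polyCM mulrCA mulVr ?mulr1.
Qed.

(** * Localizations as rings of fractions *)

Section Embedding.
Variables (R : idomainType) (S : multiplicative_subset R).

Fact loc_embed_subproof (a : R) : FracField.tofrac a \in loc_pred S.
Proof.
have [S1 _] := mset_mulr_closed S.
by apply/asboolP; exists a, 1; rewrite S1 rmorph1 divr1.
Qed.

Definition loc_embed (a : R) : localization S :=
  exist _ (FracField.tofrac a) (loc_embed_subproof a).

Fact loc_embed_is_zmod_morphism : zmod_morphism loc_embed.
Proof. by move=> a b; apply: val_inj; rewrite /= rmorphB. Qed.

Fact loc_embed_is_monoid_morphism : monoid_morphism loc_embed.
Proof.
by split=> [|a b]; apply: val_inj; rewrite /= ?rmorph1 ?rmorphM.
Qed.

HB.instance Definition _ := GRing.isZmodMorphism.Build R (localization S)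
  loc_embed loc_embed_is_zmod_morphism.
HB.instance Definition _ := GRing.isMonoidMorphism.Build R (localization S)
  loc_embed loc_embed_is_monoid_morphism.

Lemma loc_embed_inj : injective loc_embed.
Proof. by move=> a b /(congr1 val)/eqP; rewrite /= tofrac_eq => /eqP. Qed.

Lemma loc_embed_unit s : s \in S -> loc_embed s \is a GRing.unit.
Proof.
move=> Ss; have s0 : FracField.tofrac s != 0.
  by rewrite tofrac_eq0; apply: contraNneq (mset_neq0 S) => <-.
have sV : (FracField.tofrac s)^-1 \in loc_pred S.
  by apply/asboolP; exists 1, s; rewrite rmorph1 mul1r.
apply/unitrP; exists (exist (fun x => x \in loc_pred S) _ sV : localization S).
by split; apply: val_inj; rewrite /= ?mulVf ?mulfV.
Qed.

Lemma loc_fraction (y : localization S) :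
  exists a s, s \in S /\ y = loc_embed a / loc_embed s.
Proof.
have /asboolP[a [s [Ss def_y]]] := valP y; exists a, s; split=> //.
have Us := loc_embed_unit Ss.
apply: (mulIr Us); rewrite mulrVK //; apply: val_inj.
rewrite rmorphM /= def_y mulfVK // tofrac_eq0.
by apply: contraNneq (mset_neq0 S) => <-.
Qed.

Lemma fractions_loc : fractions_of loc_embed.
Proof.
split=> [|y]; first exact: loc_embed_inj.
have [a [s [Ss ->]]] := loc_fraction y.
by exists a, s; rewrite loc_embed_unit.
Qed.

Lemma loc_embed_unitP r :
  reflect (exists t, r * t \in S) (loc_embed r \is a GRing.unit).
Proof.
apply: (iffP idP) => [Ur | [t /loc_embed_unit]]; last first.
  by rewrite rmorphM unitrM => /andP[].
have [b [s [Ss def_V]]] := loc_fraction (loc_embed r)^-1.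
exists b; suff -> : r * b = s by [].
have Us := loc_embed_unit Ss.
apply: loc_embed_inj; rewrite rmorphM /= -[loc_embed b](mulrVK Us) -def_V.
by rewrite mulrA mulrV // mul1r.
Qed.

End Embedding.

(** The complement of a prime is saturated: it contains the divisors of its
    elements. *)
Lemma prime_loc_unit (R : idomainType) (P : prime_idealr R) r :
  (loc_embed (prime_compl P) r \is a GRing.unit) = (r \notin P).
Proof.
apply/loc_embed_unitP/idP => [[t] | rP].
  by rewrite inE /= prime_idealrM negb_or => /andP[].
by exists 1; rewrite mulr1.
Qed.

(** * Contraction and extension of primes *)

Lemma exists_prime (R : idomainType) (I : {pred R}) :
    idealr_closed I -> prime_idealr_closed I ->
  exists P : prime_idealr R, P =i I.
Proof.
move=> idI prI.
pose P : prime_idealr R :=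
  HB.pack I (isIdealr.Build R I idI) (isPrimeIdealrClosed.Build R I prI).
by exists P.
Qed.

Lemma prime_preim (R L : idomainType) (f : {rmorphism R -> L})
    (Q : prime_idealr L) :
  exists P : prime_idealr R, forall r, (r \in P) = (f r \in Q).
Proof.
have [|u v|P defP] := @exists_prime R [pred r | f r \in Q].
- split=> [||a u v]; rewrite !inE ?rmorph0 ?rmorph1 ?idealr0 ?idealr1 //.
  by rewrite rmorphD rmorphM => Qu Qv; rewrite rpredD // idealMr.
- by rewrite !inE rmorphM prime_idealrM.
- by exists P => r; rewrite defP inE.
Qed.

(** A prime disjoint from S extends to a prime of the localization that
    contracts back to it; disjointness is what keeps the extension proper. *)
Lemma prime_extend (R : idomainType) (S : multiplicative_subset R)
    (P : prime_idealr R) :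
    {in S, forall s, s \notin P} ->
  exists Q : prime_idealr (localization S),
    forall r, (loc_embed S r \in Q) = (r \in P).
Proof.
move=> disj; have [S1 SM] := mset_mulr_closed S.
pose I : {pred localization S} :=
  fun y => `[< exists s, s \in S /\ exists2 a, a \in P
                & y * loc_embed S s = loc_embed S a >].
have Iembed r : (loc_embed S r \in I) = (r \in P).
  apply/asboolP/idP => [[s [Ss [a Pa]]] | Pr]; last first.
    by exists 1; split=> //; exists r; rewrite // rmorph1 mulr1.
  rewrite -rmorphM => /loc_embed_inj def_a; move: Pa.
  by rewrite -def_a prime_idealrM (negPf (disj s Ss)) orbF.
have IM x y : y \in I -> x * y \in I.
  move=> /asboolP[s [Ss [a Pa def_a]]].
  have [b [t [St ->]]] := loc_fraction x; apply/asboolP; exists (t * s).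
  split; first exact: SM.
  exists (b * a); first exact: idealMr.
  by rewrite !rmorphM /= -def_a mulrACA mulrVK ?loc_embed_unit.
(* Multiplying by the unit s does not change membership in I, so the primality
   of I can be tested on numerators. *)
have Idiv s y : s \in S -> (y * loc_embed S s \in I) = (y \in I).
  move=> Ss; apply/idP/idP => [Iys | Iy]; last by rewrite mulrC IM.
  by rewrite -[y](mulrK (loc_embed_unit Ss)) mulrC IM.
have [|x y|Q defQ] := @exists_prime _ I.
- split=> [||a u v].
  + by rewrite -(rmorph0 (loc_embed S)) Iembed idealr0.
  + by rewrite -(rmorph1 (loc_embed S)) Iembed idealr1.
  + move=> /(IM a)/asboolP[s [Ss [b Pb def_b]]].
    move=> /asboolP[t [St [c Pc def_c]]]; apply/asboolP; exists (s * t).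
    split; first exact: SM.
    exists (b * t + s * c); first by rewrite mulrC rpredD // idealMr.
    rewrite rmorphD !rmorphM /= -def_b -def_c mulrDl mulrA; congr (_ + _).
    by rewrite mulrCA.
- have [a [s [Ss ->]]] := loc_fraction x.
  have [b [t [St ->]]] := loc_fraction y.
  rewrite mulrACA -invrM ?loc_embed_unit // -(Idiv (t * s)) ?SM //.
  rewrite rmorphM mulrVK ?unitrM ?loc_embed_unit // -rmorphM Iembed.
  rewrite prime_idealrM -(Idiv s) // -[_ / _ \in I](Idiv t) //.
  by rewrite !mulrVK ?loc_embed_unit // !Iembed.
- by exists Q => r; rewrite defQ Iembed.
Qed.

(** * Isomorphisms between localizations at primes *)

Lemma isomorphic_sym (R S : idomainType) : isomorphic R S -> isomorphic S R.
Proof.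
move=> [f [g fK gK]].
pose gr : {rmorphism S -> R} := HB.pack g
  (GRing.isZmodMorphism.Build S R g (can2_zmod_morphism fK gK))
  (GRing.isMonoidMorphism.Build S R g (can2_monoid_morphism fK gK)).
by exists gr; exists f.
Qed.

(** Localizing in two steps: both rings invert exactly the elements of R
    outside P. *)
Lemma loc_prime_trans (R : idomainType) (S : multiplicative_subset R)
    (Q : prime_idealr (localization S)) (P : prime_idealr R) :
    (forall r, (r \in P) = (loc_embed S r \in Q)) ->
  isomorphic (localization (prime_compl P)) (localization (prime_compl Q)).
Proof.
move=> PQ; apply: fractions_isom.
- exact: fractions_loc.
- exact: fractions_comp (fractions_loc S) (fractions_loc (prime_compl Q)).
- by move=> s /=; rewrite !prime_loc_unit PQ.
Qed.

Lemma image_mset (R L : idomainType) (f : {rmorphism R -> L})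
    (S : multiplicative_subset R) :
    injective f ->
  exists T : multiplicative_subset L,
    forall y, y \in T <-> exists2 s, s \in S & y = f s.
Proof.
move=> f_inj; have [S1 SM] := mset_mulr_closed S.
pose T : {pred L} := fun y => `[< exists2 s, s \in S & y = f s >].
have TM : mulr_closed T.
  split=> [|_ _ /asboolP[s Ss ->] /asboolP[t St ->]]; apply/asboolP.
    by exists 1; rewrite ?rmorph1.
  by exists (s * t); rewrite ?rmorphM // SM.
have T0 : 0 \notin T.
  apply/asboolP=> -[s Ss]; rewrite -(rmorph0 f) => /f_inj s0.
  by case/negP: (mset_neq0 S); rewrite s0.
exists (MultiplicativeSubset TM T0) => y.
by split=> [/asboolP | ?]; last apply/asboolP.
Qed.

(** If passing from R to L only inverts elements outside Q, the remaining
    elements outside Q can be inverted afterwards: the localization of R at Q is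
    also one of L, at the image of the complement of Q. *)
Lemma fractions_loc_prime (R L : idomainType) (f : {rmorphism R -> L})
    (Q : prime_idealr R) :
    fractions_of f -> (forall s, f s \is a GRing.unit -> s \notin Q) ->
  exists T : multiplicative_subset L,
    isomorphic (localization T) (localization (prime_compl Q)).
Proof.
move=> fF fQ; have [f_inj fP] := fF.
have [T TP] := image_mset (prime_compl Q) f_inj.
exists T; apply: fractions_isom.
- exact: fractions_comp fF (fractions_loc T).
- exact: fractions_loc.
move=> r; rewrite prime_loc_unit /=; apply/loc_embed_unitP/idP => [[t] | rQ].
  move=> /TP[s sQ def_s]; have [b [c [Uc def_t]]] := fP t.
  have : f (r * b) = f (s * c).
    by rewrite !rmorphM /= -def_s def_t -!mulrA mulVr ?mulr1.
  move=> /f_inj rb_sc; apply: contra (fQ c Uc) => Qr.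
  have : s * c \in Q by rewrite -rb_sc prime_idealrM Qr.
  by rewrite prime_idealrM (negPf sQ).
by exists 1; apply/TP; exists r; rewrite ?mulr1.
Qed.

(** * The Nagata ring of a localization at a prime *)

Lemma N_unit_coef (R : idomainType) (f : {poly R}) i :
  f`_i \is a GRing.unit -> f \in @N_pred R.
Proof.
move=> Uf; apply/asboolP => x; apply/asboolP => I [I0 IZ] fI.
have If : f`_i \in I.
  apply/fI/mem_nth; rewrite ltnNge; apply: contraL Uf => /(nth_default 0)->.
  by rewrite unitr0.
by have := IZ (x / f`_i) _ 0 If I0; rewrite addr0 /GRing.scale /= mulrVK.
Qed.

(** P is an ideal without 1, so it cannot contain a set of coefficients that
    generates the unit ideal. *)
Lemma N_notin_polyOver (R : idomainType) (P : prime_idealr R) (f : {poly R}) :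
  f \in @N_pred R -> f \isn't a polyOver P.
Proof.
move=> /asboolP cf; apply/negP=> /polyOverP Pf.
have /asboolP : content f 1 by exact: (cf 1).
move=> genP; suff: 1 \in (P : {pred R}) by rewrite idealr1.
apply: genP.
- split=> [|a u v Pu Pv]; first exact: idealr0.
  by rewrite rpredD //; exact: idealMr.
- by move=> _ /(nthP 0)[i _ <-]; apply: Pf.
Qed.

(** In the local ring of R at P every element outside the extension of P is
    a unit, so unit content means having a coefficient outside that
    extension. *)
Lemma N_map_prime_loc (R : idomainType) (P : prime_idealr R) (f : {poly R}) :
  (map_poly (loc_embed (prime_compl P)) f \in @N_pred _) =
  (f \isn't a polyOver P).
Proof.
apply/idP/idP => [Nf | /negP Pf]; last first.
  have [i fi] : exists i, f`_i \notin P.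
    apply: contrapT => nP; apply/Pf/polyOverP => i.
    by apply: contrapT => /negP fi; apply: nP; exists i.
  by apply: (@N_unit_coef _ _ i); rewrite coef_map prime_loc_unit.
have [Q QP] := @prime_extend R (prime_compl P) P (fun _ => id).
apply: contra (N_notin_polyOver Q Nf) => /polyOverP Pf.
by apply/polyOverP => i; rewrite coef_map /= QP.
Qed.

(** P[t] is prime because N is multiplicatively closed: by N_map_prime_loc,
    the complement of P[t] is the preimage of the set N of the localization
    at P. *)
Lemma prime_polyOver (R : idomainType) (P : prime_idealr R) :
  exists Q : prime_idealr {poly R}, forall f, (f \in Q) = (f \is a polyOver P).
Proof.
have [|f g|Q defQ] := @exists_prime _ [pred f | f \is a polyOver P].
- split=> [||a f g]; rewrite !inE ?rpred0 //.
    by rewrite polyOverC idealr1.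
  move=> /polyOverP Pf Pg; rewrite rpredD //; apply/polyOverP => i.
  by rewrite coefM rpred_sum // => j _; rewrite idealMr.
- rewrite !inE; apply: contraTT; rewrite negb_or -!N_map_prime_loc rmorphM.
  by move=> /andP[Nf Ng]; apply: (N_mulr_closed _).2.
- by exists Q.
Qed.

(** Both rings are rings of fractions of R[t], the second one through
    the polynomial ring over the localization at P; a polynomial becomes a unit
    in either of them exactly when it is outside P[t]. *)
Lemma nagata_prime_loc (R : idomainType) (P : prime_idealr R)
    (Q : prime_idealr {poly R}) :
    (forall f, (f \in Q) = (f \is a polyOver P)) ->
  isomorphic (localization (prime_compl Q))
             (nagata_ring (localization (prime_compl P))).
Proof.
move=> QP; have mapF := fractions_map_poly (fractions_loc (prime_compl P)).
apply: fractions_isom.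
- exact: fractions_loc.
- exact: fractions_comp mapF (fractions_loc (N_set _)).
move=> f; rewrite prime_loc_unit QP /=.
apply/idP/loc_embed_unitP => [Pf | [t Nft]].
  by exists 1; rewrite mulr1 [_ \in _]N_map_prime_loc.
have [Q' Q'P] := @prime_extend R (prime_compl P) P (fun _ => id).
apply: contra (N_notin_polyOver Q' Nft) => /polyOverP Pf.
apply/polyOverP=> i; rewrite coefM rpred_sum // => j _.
by rewrite mulrC idealMr // coef_map /= Q'P.
Qed.

(** * Transfer of local properties *)

Lemma locally_localization (X : idomainType -> Prop) (R : idomainType)
    (S : multiplicative_subset R) :
  isom_invariant X -> locally X R -> locally X (localization S).
Proof.
move=> Xisom XR Q; have [P PQ] := prime_preim (loc_embed S) Q.
exact: Xisom (loc_prime_trans PQ) (XR P).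
Qed.

Lemma locally_poly (X : idomainType -> Prop) (R : idomainType) :
    isom_invariant X -> stable_quotient X -> stable_polynomial X ->
  locally X R -> locally X {poly R}.
Proof.
move=> Xisom Xquotient Xpoly XR Q.
have [P PQ] := prime_preim polyC Q.
have mapF := fractions_map_poly (fractions_loc (prime_compl P)).
(* A polynomial that becomes a unit over the localization at P is a constant
   outside P, hence it is outside Q. *)
have [|T TQ] := fractions_loc_prime (Q := Q) mapF.
  move=> f /=; rewrite poly_unitE size_map_inj_poly ?rmorph0 //; last first.
    exact: loc_embed_inj.
  move=> /andP[/size_poly1P[c _ ->]]; rewrite coef_map /= coefC /=.
  by rewrite prime_loc_unit PQ.
exact: Xisom TQ (Xquotient _ (Xpoly _ (XR P)) T).
Qed.

(** P[t] is disjoint from T, so the Nagata ring of the localization at P is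
    a localization of R[t] at a prime that extends to R[t]_T. *)
Lemma locally_of_poly_loc (X : idomainType -> Prop) (R : idomainType)
    (T : multiplicative_subset {poly R}) :
    isom_invariant X -> (forall D : idomainType, X (nagata_ring D) -> X D) ->
    {subset T <= @N_pred R} ->
  locally X (localization T) -> locally X R.
Proof.
move=> Xisom Xnagata TN XT P; apply: Xnagata.
have [Q QP] := prime_polyOver P.
have [|Q' Q'Q] := @prime_extend _ T Q.
  by move=> f /TN Nf; rewrite QP N_notin_polyOver.
apply: (Xisom _ _ (nagata_prime_loc QP)).
exact: (Xisom _ _ (isomorphic_sym (loc_prime_trans (fsym Q'Q))) (XT Q')).
Qed.

Theorem theorem2p10 (D : idomainType) (X : idomainType -> Prop)
    (Xisom : isom_invariant X)
    (Xquotient : stable_quotient X)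
    (Xpoly : stable_polynomial X)
    (Xnagata : forall R : idomainType, X (nagata_ring R) -> X R) :
  [<-> locally X D;
       locally X {poly D};
       locally X (anderson_ring D);
       locally X (serre_ring D);
       locally X (nagata_ring D)].
Proof.
have up (T : multiplicative_subset {poly D}) :
    locally X D -> locally X (localization T).
  by move=> XD; apply: locally_localization => //; apply: locally_poly.
have down (T : multiplicative_subset {poly D}) :
    {subset T <= @N_pred D} -> locally X (localization T) -> locally X D.
  exact: locally_of_poly_loc.
tfae.
- exact: locally_poly.
- exact: locally_localization.
- move=> XA; apply/up/(down (A_set D)) => // f /eqP f1.
  by apply: (@N_unit_coef _ _ 0); rewrite -horner_coef0 f1 unitr1.
- move=> XU; apply/up/(down (U_set D)) => // f /monicP f1.
  by apply: (@N_unit_coef _ _ (size f).-1); rewrite -lead_coefE f1 unitr1.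
- exact: down.
Qed.
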